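(* Let $(C(t))_{t\geq 0}$ be a strongly continuous cosine family on a Banach space $X$ and let $a\geq 0$. If there is a real number $r<1$ such that $$\sup_{t\geq 0}\|C(t)-\cos(at)I\|<r,$$ then $C(t)=\cos(at)I$ for all $t\geq 0$.
   Context: A cosine family on a Banach space $X$ is a family $(C(t))_{t\geq 0}$ of bounded linear operators on $X$ with $C(0)=I$ and $2C(t)C(s)=C(t+s)+C(|t-s|)$ for all $t,s\geq 0$. It is strongly continuous if $t\mapsto C(t)x$ is continuous on $[0,\infty)$ for every $x\in X$. $I$ denotes the identity operator on $X$ and $\|\cdot\|$ the operator norm. *)

(* Defs.v *)
From HB Require Import structures.
From mathcomp Require Import all_boot all_order all_algebra.
From mathcomp Require Import complex.
From mathcomp Require Import all_classical all_reals all_analysis.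
Set Implicit Arguments.
Unset Strict Implicit.
Unset Printing Implicit Defensive.
Import Order.TTheory GRing.Theory Num.Theory.
Import numFieldNormedType.Exports.
Local Open Scope classical_set_scope.
Local Open Scope ring_scope.

Definition bounded_operator (K : numFieldType) (X : normedModType K)
    (A : X -> X) : Prop :=
  exists M : K, forall x : X, `|A x| <= M * `|x|.

(* Norms on a normedModType K have values in K, while suprema are taken in
   \bar R; [re] reads such a value back as a real number. It is idfun when
   K = R, and the real part when K = R[i], where norms have zero imaginary
   part. *)
Definition opnorm (R : realType) (K : numFieldType) (re : K -> R)
    (X : normedModType K) (A : X -> X) : \bar R :=
  ereal_sup [set (re `|A x|)%:E | x in [set x : X | `|x| <= 1]].

(* The family is indexed by [0, +oo[: the values C t with t < 0 are
   irrelevant here and in [strongly_continuous]. *)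
Record cosine_family (R : realType) (K : numFieldType) (X : normedModType K)
    (C : R -> {linear X -> X}) : Prop := CosineFamily {
  cosine_bounded : forall t, 0 <= t -> bounded_operator (C t) ;
  cosine0 : forall x, C 0 x = x ;
  cosineD : forall t s, 0 <= t -> 0 <= s ->
    forall x, 2 *: C t (C s x) = C (t + s) x + C `|t - s| x }.

Definition strongly_continuous (R : realType) (K : numFieldType)
    (X : normedModType K) (C : R -> {linear X -> X}) : Prop :=
  forall x : X, {within [set t : R | 0 <= t], continuous (fun t => C t x)}.

(* Main.v *)
Require Import Defs.
From HB Require Import structures.
From mathcomp Require Import all_boot all_order all_algebra.
From mathcomp Require Import complex.
From mathcomp Require Import all_classical all_reals all_analysis.
From mathcomp Require Import ring lra.
Import Order.TTheory GRing.Theory Num.Theory.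
Import numFieldNormedType.Exports.
Local Open Scope classical_set_scope.
Local Open Scope ring_scope.
Local Open Scope complex_scope.

(* Suppose a > 0 and let p = 2 pi / a. Since C(2t) - I = 4 D + 2 D^2 for
   D = C(t) - I, the norm of D at least doubles along 2^n p as long as it is
   smaller than 1; hence C(p) = I. One then halves the time. If
   C(2s) = cos(2as) I, then C(s)^2 = cos(as)^2 I, so a vector y in the range of
   C(s) - cos(as) I satisfies C(s) y = - cos(as) y, and thus
   2 |cos(as)| |y| <= r |y|, which forces y = 0 when |cos(as)| >= 1/2. Along
   s = p / 2^j this only fails for s = p / 4, where C(s)^2 = 0; there
   C(3s) = - 3 C(s), and boundedness along 3^n s gives C(s) = 0. So the claim
   holds at all multiples of all p / 2^j, and strong continuity concludes. *)

Section ScalarCosine.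

(* K stands for R or R[i]: iota embeds the reals, and re reads norms back. *)
Context {R : realType} {K : numFieldType}.
Context (iota : {rmorphism R -> K}) (re : K -> R).
Hypothesis iota_le : {mono iota : u v / u <= v}.
Hypothesis iota_re : forall k : K, 0 <= k -> iota (re k) = k.

(** * Real scalars and norm bounds in [K] *)

Lemma iota_lt : {mono iota : u v / u < v}.
Proof. exact: leW_mono. Qed.

Lemma norm_iota (u : R) : `|iota u| = iota `|u|.
Proof.
have [u0|u0] := leP 0 u.
  by rewrite !ger0_norm// -(rmorph0 iota) iota_le.
by rewrite !ltr0_norm ?rmorphN// -(rmorph0 iota) iota_lt.
Qed.

Lemma iota_continuous : continuous iota.
Proof.
move=> u; apply/cvgrPdist_lt => e e0.
(* A positive [e] of [K] is [iota d] with [d] real, so closeness in [K] reduces to closeness in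
   [R]. *)
have := iota_re _ (ltW e0); move: (re e) => d de.
move: e0; rewrite -de -(rmorph0 iota) iota_lt => d0.
near=> v.
rewrite -rmorphB norm_iota iota_lt.
by near: v; exact: cvgr_dist_lt.
Unshelve. all: by end_near. Qed.

Context {X : normedModType K}.

(** Iterating gives 2^n |f 0| <= M for all n. Both sides are read back in [R], where the archimedean
    property rules out |f 0| > 0. *)
Lemma doubling_bounded_eq0 (f : nat -> X) (M : K) :
  (forall n, 2 * `|f n| <= `|f n.+1|) -> (forall n, `|f n| <= M) -> f 0%N = 0.
Proof.
move=> f2 fM; apply/eqP; rewrite -normr_eq0.
have fpow n : 2 ^+ n * `|f 0%N| <= `|f n|.
  elim: n => [|n IHn]; first by rewrite mul1r.
  by rewrite exprS -mulrA (le_trans _ (f2 n))// ler_wpM2l.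
set u := re `|f 0%N|; have fu : `|f 0%N| = iota u by rewrite iota_re.
have Mm : iota (re M) = M by rewrite iota_re// (le_trans _ (fM 0%N)).
have u0 : 0 <= u by rewrite -iota_le rmorph0 -fu.
have um n : 2 ^+ n * u <= re M.
  rewrite -iota_le rmorphM rmorphXn rmorph_nat -fu Mm.
  exact: le_trans (fpow n) (fM n).
rewrite fu fmorph_eq0; apply: contraT => un0.
have u_gt0 : 0 < u by rewrite lt_def un0.
have := um (Num.bound (re M / u)).
by rewrite -ler_pdivlMr// leNgt upper_nthrootP.
Qed.

Lemma opnorm_lt_bound (A : X -> X) (r : R) (x : X) : scalable A ->
  (opnorm re A < r%:E)%E -> `|A x| <= iota r * `|x|.
Proof.
move=> AZ Ar; have [->|x0] := eqVneq x 0.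
  by have := AZ 0 0; rewrite !scale0r => ->; rewrite normr0 mulr0.
have nx0 : 0 < `|x| by rewrite normr_gt0.
rewrite -ler_pdivrMr// mulrC.
have -> : `|x|^-1 * `|A x| = `|A (`|x|^-1 *: x)|.
  by rewrite AZ normrZ normfV normr_id.
rewrite -(iota_re _ (normr_ge0 _)) iota_le -lee_fin.
apply: ltW; apply: le_lt_trans Ar.
apply: ereal_sup_ubound; exists (`|x|^-1 *: x) => //=.
by rewrite normrZ normfV normr_id mulVf// normr_eq0.
Qed.

(** * Dyadic fractions of a period *)

Context {C : R -> {linear X -> X}} {a r : R}.
Hypothesis cosC : cosine_family C.
Hypothesis r_lt1 : r < 1.
Hypothesis close : forall t, 0 <= t ->
  forall x, `|C t x - iota (cos (a * t)) *: x| <= iota r * `|x|.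

Lemma contracted_eq0 (x : X) (q : R) :
  1 <= q -> iota q * `|x| <= iota r * `|x| -> x = 0.
Proof.
move=> q1 qr; apply: contrapT => /eqP x0; move: qr.
rewrite ler_pM2r ?normr_gt0// iota_le leNgt => /negP; apply.
exact: lt_le_trans r_lt1 q1.
Qed.

Lemma cosine_product (t s : R) (x : X) : 0 <= s -> s <= t ->
  C t (C s x) *+ 2 = C (t + s) x + C (t - s) x.
Proof.
move=> s0 st; have := cosineD cosC (le_trans s0 st) s0 x.
by rewrite (ger0_norm (_ : 0 <= t - s)) ?subr_ge0// scaler_nat.
Qed.

Lemma cosine_double (t : R) (x : X) :
  0 <= t -> C t (C t x) *+ 2 = C (t *+ 2) x + x.
Proof. by move=> t0; rewrite cosine_product// subrr (cosine0 cosC) mulr2n. Qed.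

Lemma cosine_eq1 (t : R) (x : X) : 0 <= t -> cos (a * t) = 1 -> C t x = x.
Proof.
move=> t0 at1; apply/subr0_eq.
have st n : 0 <= t *+ 2 ^ n by rewrite mulrn_wge0.
have ct n : cos (a * (t *+ 2 ^ n)) = 1.
  elim: n => [//|n IHn].
  by rewrite expnSr mulrnA mulrnAr cos_mulr2n IHn expr1n mulr2n addrK.
have bnd n y : `|C (t *+ 2 ^ n) y - y| <= iota r * `|y|.
  by have := close _ (st n) y; rewrite ct rmorph1 scale1r.
pose f n := C (t *+ 2 ^ n) x - x.
rewrite -[LHS]/(f 0%N); apply: (@doubling_bounded_eq0 f (iota r * `|x|)) => n;
  last exact: bnd.
set S := C (t *+ 2 ^ n).
(* With D = S - I, [f n] is D x and [S (f n) - f n] is D^2 x. *)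
have -> : f n.+1 = f n *+ 4 + (S (f n) - f n) *+ 2.
  rewrite [_ *+ 4](mulrnDr _ 2 2) -addrA -mulrnDl subrKC -mulrnDl.
  rewrite /f expnSr mulrnA linearB /= addrC subrKA mulrnBl.
  by rewrite (cosine_double _ _ (st n)) mulr2n opprD addrA addrK.
rewrite (le_trans _ (lerB_normD _ _))// !normrMn.
(* Since r < 1, |D^2 x| <= |D x|; hence |f (n+1)| >= 4 |f n| - 2 |f n|. *)
have : `|S (f n) - f n| <= `|f n|.
  rewrite (le_trans (bnd n _))// ler_piMl// -(rmorph1 iota) iota_le.
  exact: ltW.
by rewrite mulr_natl lerBrDr (mulrnDr _ 2 2) lerD2l lerMn2r.
Qed.

Lemma cosine_halve (s : R) : 0 <= s -> - 2^-1 <= cos (a * (s *+ 2)) ->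
  (forall x, C (s *+ 2) x = iota (cos (a * (s *+ 2))) *: x) ->
  forall x, C s x = iota (cos (a * s)) *: x.
Proof.
move=> s0 c2 C2 x; apply/subr0_eq.
set k := cos (a * s); set y := _ - _.
have k2 : cos (a * (s *+ 2)) = k ^+ 2 *+ 2 - 1 by rewrite mulrnAr cos_mulr2n.
have CC : C s (C s x) = iota (k ^+ 2) *: x.
  apply: (@scalerI _ _ (2 : K)); rewrite ?pnatr_eq0// !scaler_nat.
  rewrite cosine_double// C2 k2 rmorphB rmorph1 scalerBl scale1r subrK.
  by rewrite rmorphMn scalerMnl.
(* This is (C(s) + k)(C(s) - k) = 0 applied to x. *)
have Cy : C s y = - (iota k *: y).
  by rewrite /y linearB linearZ CC /= scalerBr scalerA -rmorphM opprB.
(* By the double-angle formula, cos(2as) >= -1/2 says exactly that 4 k^2 >= 1. *)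
apply: (@contracted_eq0 _ (`|k| *+ 2)).
  rewrite -(@ler_pXn2r _ 2) ?nnegrE ?mulrn_wge0//.
  rewrite exprMn_n real_normK ?num_real//; move: c2; rewrite k2; lra.
have := close _ s0 y; rewrite -/k Cy -opprD normrN -mulr2n.
by rewrite normrMn normrZ norm_iota -mulrnAl -rmorphMn.
Qed.

(** Here C(s)^2 = 0, so halving gives no information. Tripling does: 2 C(2u) C(u) = C(3u) + C(u)
    with C(2u) = -I yields C(3u) = -3 C(u), and C(6u) = -I again, so the step repeats. Meanwhile
    cos(3^n as) stays 0, which bounds C(3^n s) x by r |x|. *)
Lemma cosine_eq0 (s : R) : 0 <= s -> cos (a * s) = 0 ->
  (forall x, C (s *+ 2) x = - x) -> forall x, C s x = 0.
Proof.
move=> s0 as0 C2 x.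
have st n : 0 <= s *+ 3 ^ n by rewrite mulrn_wge0.
have ct n : cos (a * (s *+ 3 ^ n)) = 0.
  elim: n => [//|n IHn].
  rewrite expnSr mulrnA mulrSr mulrDr mulrnAr cosD IHn mulr0 sin_mulr2n IHn.
  by rewrite mul0r mul0rn mul0r subr0.
have triple u : 0 <= u -> (forall y, C (u *+ 2) y = - y) ->
    (forall y, C (u *+ 3) y = - (C u y *+ 3)) /\
    (forall y, C (u *+ 3 *+ 2) y = - y).
  move=> u0 Cu; have Cu3 y : C (u *+ 3) y = - (C u y *+ 3).
    have := cosine_product (u *+ 2) u y u0.
    rewrite -mulrSr [u *+ 2 - u]addrK Cu mulr2n lerDl => /(_ u0).
    by move=> /esym/(canRL (addrK _)) ->; rewrite mulrSr mulr2n !opprD.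
  split=> // y; have := cosine_double _ y (mulrn_wge0 3 u0).
  have CC := cosine_double u y u0; rewrite Cu addNr in CC.
  rewrite !Cu3 linearN (linearMn (C u)) /= !mulNrn opprK.
  (* The 9 is (-3)^2, coming from C(3u)^2 = 9 C(u)^2. *)
  rewrite (_ : _ *+ 2 = C u (C u y) *+ 2 *+ 9); last by rewrite -!mulrnA.
  rewrite CC mul0rn.
  by move=> /esym/eqP; rewrite addr_eq0 => /eqP.
have C2n n y : C (s *+ 3 ^ n *+ 2) y = - y.
  elim: n y => [//|n IHn]; rewrite expnSr mulrnA.
  exact: (triple _ (st n) IHn).2.
pose f n := C (s *+ 3 ^ n) x.
rewrite -[LHS]/(f 0%N); apply: (@doubling_bounded_eq0 f (iota r * `|x|)) => n.
  rewrite /f expnSr mulrnA (triple _ (st n) (C2n n)).1 normrN normrMn mulr_natl.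
  exact: ler_wpMn2l.
by have := close _ (st n) x; rewrite ct rmorph0 scale0r subr0.
Qed.

Lemma cosine_dyadic (p : R) (j : nat) : 0 <= p -> a * p = pi *+ 2 ->
  forall x, C (p / 2 ^+ j) x = iota (cos (a * (p / 2 ^+ j))) *: x.
Proof.
move=> p0 ap.
have pj n : 0 <= p / 2 ^+ n by rewrite divr_ge0// exprn_ge0.
have pS n : (p / 2 ^+ n.+1) *+ 2 = p / 2 ^+ n.
  by rewrite -mulr_natr exprSr invfM mulrA divfK.
elim: j => [|[|[|j]] IH].
- move=> x; rewrite expr0 divr1 ap cos2pi rmorph1 scale1r.
  by apply: cosine_eq1 => //; rewrite ap cos2pi.
- apply: cosine_halve; rewrite ?pS// expr0 divr1 ap cos2pi; lra.
(* At p / 4 the doubled angle is pi, whose cosine -1 is too small for [cosine_halve]. *)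
- have a4 : a * (p / 2 ^+ 2) = pi / 2.
    rewrite mulrA ap -mulr_natr exprS expr1 invfM; lra.
  move=> x; rewrite a4 cos_pihalf rmorph0 scale0r; apply: cosine_eq0 => //.
    by rewrite a4 cos_pihalf.
  move=> y; rewrite pS IH expr1 mulrA ap -[pi *+ 2]mulr_natr mulfK ?pnatr_eq0//.
  by rewrite cospi rmorphN rmorph1 scaleN1r.
(* From p / 8 on, the doubled angle lies in [0, pi / 2], so its cosine is nonnegative. *)
- apply: cosine_halve; rewrite ?pS//.
  apply: (@le_trans _ _ 0); first lra.
  apply: cos_ge0_pihalf; rewrite mulrA ap.
  have jp : (pi : R) *+ 2 / 2 ^+ j.+2 = pi / 2 / 2 ^+ j.
    by rewrite !exprS !invfM -[pi *+ 2]mulr_natr; field; rewrite expf_neq0.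
  rewrite jp; apply/andP; split.
    apply: (@le_trans _ _ 0); first by rewrite oppr_le0 divr_ge0// pi_ge0.
    by rewrite !divr_ge0 ?pi_ge0// exprn_ge0.
  rewrite ler_pdivrMr ?exprn_gt0// ler_peMr ?divr_ge0 ?pi_ge0//.
  by rewrite exprn_ege1// ler1n.
Qed.

(** * From dyadic fractions to all times *)

Lemma cosine_multiple (s : R) : 0 <= s ->
  (forall x, C s x = iota (cos (a * s)) *: x) ->
  forall n x, C (s *+ n) x = iota (cos (a * (s *+ n))) *: x.
Proof.
move=> s0 Cs n x.
(* The functional equation is a two-term recurrence in n, so two consecutive values are carried
   along. *)
suff [] : C (s *+ n) x = iota (cos (a * (s *+ n))) *: x /\
  C (s *+ n.+1) x = iota (cos (a * (s *+ n.+1))) *: x by [].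
elim: n => [|n [IH0 IH1]].
  by rewrite mulr0n mulr0 cos0 rmorph1 scale1r (cosine0 cosC) mulr1n.
split=> //.
have sn : s <= s *+ n.+1 by rewrite mulrS lerDl mulrn_wge0.
have sB : s *+ n.+1 - s = s *+ n by rewrite mulrSr addrK.
have /eqP := cosine_product (s *+ n.+1) s x s0 sn; rewrite -mulrSr sB.
rewrite Cs linearZ /= IH0 IH1 -subr_eq => /eqP <-.
rewrite scalerA scalerMnl -scalerBl -rmorphM -rmorphMn -rmorphB.
congr (iota _ *: _).
by rewrite [s *+ n.+2]mulrSr -sB mulrBr mulrDr cosB cosD; ring.
Qed.

Lemma cosine_dense (t : R) (x : X) : strongly_continuous C -> 0 <= t ->
  (forall d, 0 < d -> exists s, [/\ 0 <= s, `|t - s| < d &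
     C s x = iota (cos (a * s)) *: x]) ->
  C t x = iota (cos (a * t)) *: x.
Proof.
move=> Ccont t0 dense; apply/subr0_eq.
pose g s := C s x - iota (cos (a * s)) *: x.
have cosx : {for t, continuous (fun s => iota (cos (a * s)) *: x)}.
  apply: (@continuous_comp _ _ _ (fun s => iota (cos (a * s))) ( *:%R^~ x)).
    apply: (@continuous_comp _ _ _ (fun s => cos (a * s)) iota).
      apply: (@continuous_comp _ _ _ ( *%R a) cos).
        exact: mulrl_continuous.
      exact: continuous_cos.
    exact: iota_continuous.
  exact: scalel_continuous.
have gcvg : g s @[s --> within [set s | 0 <= s] (nbhs t)] --> g t.
  apply: cvgB; first exact: ((subspace_continuousP _ _).1 (Ccont x)).
  apply: (cvg_within_filter (f := fun s => iota (cos (a * s)) *: x)).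
  exact: cosx.
rewrite -[LHS]/(g t); apply: contrapT => /eqP gt0.
have gt0' : 0 < `|g t| by rewrite normr_gt0.
(* Taking |g t| itself as the tolerance, a nearby zero s of g gives |g t| < |g t|. *)
move/cvgrPdist_lt : gcvg => /(_ _ gt0') gnear.
have [d d0 dg] := (@nbhs_ballP R R t _).1 gnear.
have [s [s0 ts Cs]] := dense _ d0.
by have := dg s ts s0; rewrite /g Cs subrr subr0 ltxx.
Qed.

Lemma cosine_close_eq (t : R) (x : X) :
  strongly_continuous C -> 0 <= a -> 0 <= t ->
  C t x = iota (cos (a * t)) *: x.
Proof.
move=> Ccont; rewrite le_eqVlt => /predU1P[a0 t0|a0 t0].
  (* For a = 0 there is no period p, but cos(at) = 1 at every t. *)
  rewrite -a0 mul0r cos0 rmorph1 scale1r.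
  by apply: cosine_eq1 => //; rewrite -a0 mul0r cos0.
pose p := pi *+ 2 / a.
have p0 : 0 < p by rewrite divr_gt0// mulrn_wgt0// pi_gt0.
have ap : a * p = pi *+ 2 by rewrite mulrC divfK// gt_eqF.
apply: cosine_dense => // d d0.
(* This j satisfies p / d < 2^j, so the mesh s is below d; the multiple of s just below t is then
   within d of t. *)
pose j := Num.bound (p / d); pose s := p / 2 ^+ j.
have s0 : 0 < s by rewrite divr_gt0// exprn_gt0.
have sd : s < d.
  by rewrite ltr_pdivrMr ?exprn_gt0// mulrC -ltr_pdivrMr// upper_nthrootP.
pose n := Num.truncn (t / s).
have /andP[nt tn] := truncn_itv (divr_ge0 t0 (ltW s0)).
move: nt tn; rewrite ler_pdivlMr// ltr_pdivrMr// !mulr_natl => nt tn.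
exists (s *+ n); split; first by rewrite mulrn_wge0// ltW.
  by rewrite ger0_norm ?subr_ge0// (lt_trans _ sd)// ltrBlDr -mulrS.
apply: cosine_multiple (ltW s0) _ _ _.
exact: cosine_dyadic (ltW p0) ap.
Qed.

End ScalarCosine.

Theorem cosine_near_scalar {R : realType} {K : numFieldType}
    (iota : {rmorphism R -> K}) (re : K -> R) (X : normedModType K)
    (C : R -> {linear X -> X}) (a r : R) :
  {mono iota : u v / u <= v} -> (forall k, 0 <= k -> iota (re k) = k) ->
  cosine_family C -> strongly_continuous C -> 0 <= a -> r < 1 ->
  (ereal_sup [set opnorm re (fun x : X => C t x - iota (cos (a * t)) *: x)
             | t in [set t : R | 0 <= t]]%R < r%:E)%E ->
  forall t, 0 <= t -> forall x, C t x = iota (cos (a * t)) *: x.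
Proof.
move=> iota_le iota_re cosC Ccont a0 r1 supr t t0 x.
apply: (cosine_close_eq iota re iota_le iota_re cosC r1) => // {t0}t t0 {}x.
apply: (opnorm_lt_bound iota re iota_le iota_re
  (fun x => C t x - iota (cos (a * t)) *: x)).
  by move=> k y; rewrite linearZ /= scalerBr !scalerA mulrC.
by apply: le_lt_trans supr; apply: ereal_sup_ubound; exists t.
Qed.

(* The two conjuncts are the cases of real and of complex Banach spaces. *)
Theorem theorem1p1 (R : realType) :
  (forall (X : completeNormedModType R) (C : R -> {linear X -> X}) (a : R),
     cosine_family C -> strongly_continuous C -> 0 <= a ->
     (exists2 r : R, r < 1 &
        (ereal_sup [set opnorm idfun (fun x : X => C t x - cos (a * t) *: x)
                   | t in [set t : R | 0 <= t]]%R < r%:E)%E) ->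
     forall t : R, 0 <= t -> forall x : X, C t x = cos (a * t) *: x) /\
  (forall (X : completeNormedModType R[i]) (C : R -> {linear X -> X}) (a : R),
     cosine_family C -> strongly_continuous C -> 0 <= a ->
     (exists2 r : R, r < 1 &
        (ereal_sup [set opnorm (@complex.Re R)
                          (fun x : X => C t x - (cos (a * t))%:C *: x)
                   | t in [set t : R | 0 <= t]]%R < r%:E)%E) ->
     forall t : R, 0 <= t -> forall x : X, C t x = (cos (a * t))%:C *: x).
Proof.
split=> X C a cosC Ccont a0 [r r1 supr] t t0 x.
  exact: (cosine_near_scalar idfun idfun X C a r).
apply: (cosine_near_scalar (real_complex R) (@complex.Re R) X C a r) => //.
  exact: lecR.
(* A nonnegative complex number has zero imaginary part. *)
by case=> u v; rewrite lecE /= => /andP[/eqP -> _].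
Qed.
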